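(* Let $t>1$, $s>t$, $\tau=1+s/t>2$, and set $$\eta=\frac{\tau-2}{2}>0,\qquad b=1+\frac{\eta}{2}>1,\qquad \Lambda_\tau=1+\frac{1}{\log b},\qquad Q_*=\max\bigl\{e^{e},2^{2/\eta}\bigr\}.$$ Then for every $\varepsilon>0$, $$D_{s,t}\subseteq W^{*}(\widehat\psi_\varepsilon),\qquad \widehat\psi_\varepsilon(q)=\Lambda_\tau^{\,a}\,q^{-\tau}\bigl(\log\log q\bigr)^{a},\quad a=\frac{1+\varepsilon}{t},$$ where $\widehat\psi_\varepsilon(q)$ is defined by this formula for integers $q\ge Q_*$ and by any positive values for the finitely many $q<Q_*$.
   Context: $D_{s,t}=\{x\in\mathbb R\setminus\mathbb Q:\ \sum_{n\ge1}n^{-s}|\sin(\pi nx)|^{-t}=+\infty\}$. For $\psi:\mathbb N\to(0,\infty)$, $$W^{*}(\psi)=\bigl\{x\in\mathbb R:\ |x-p/q|<\psi(q)\text{ for infinitely many coprime pairs }(p,q)\in\mathbb Z\times\mathbb N,\ q\ge1\bigr\}.$$ *)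

(* Defs.v *)
From mathcomp Require Import all_boot all_order all_algebra.
From mathcomp Require Import all_classical all_reals all_analysis.

Set Implicit Arguments.
Unset Strict Implicit.
Unset Printing Implicit Defensive.

Import Order.TTheory GRing.Theory Num.Theory.
Import numFieldNormedType.Exports.

Local Open Scope classical_set_scope.
Local Open Scope ring_scope.

(* The sum is taken in the extended reals. Its terms are nonnegative, so it is
   the supremum of the partial sums. *)
Definition Dset (R : realType) (s t : R) : set R :=
  [set x | irrational x /\
     (\sum_(1 <= n <oo)
        (n%:R `^ (- s) * `|sin (pi * n%:R * x)| `^ (- t))%:E = +oo)%E].

Definition Wstar (R : realType) (psi : nat -> R) : set R :=
  [set x | infinite_set
     [set pq : int * nat | [/\ (0 < pq.2)%N, coprimez pq.1 pq.2 &
        `|x - pq.1%:~R / pq.2%:R| < psi pq.2]]].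

Definition tau (R : realType) (s t : R) : R := 1 + s / t.

Definition eta (R : realType) (s t : R) : R := (tau s t - 2) / 2.

Definition base (R : realType) (s t : R) : R := 1 + eta s t / 2.

Definition Lambda (R : realType) (s t : R) : R := 1 + (ln (base s t))^-1.

Definition Qstar (R : realType) (s t : R) : R :=
  Num.max (expR (expR 1)) (2 `^ (2 / eta s t)).

(* Only meaningful for q >= Qstar, where ln (ln q) >= 1. *)
Definition psi_formula (R : realType) (s t eps : R) (q : nat) : R :=
  let a := (1 + eps) / t in
  Lambda s t `^ a * q%:R `^ (- tau s t) * ln (ln q%:R) `^ a.

(* Main.v *)
Require Import Defs.
From mathcomp Require Import all_boot all_order all_algebra.
From mathcomp Require Import all_classical all_reals all_analysis.
From mathcomp Require Import ring lra.

Set Implicit Arguments.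
Unset Strict Implicit.
Unset Printing Implicit Defensive.

Import Order.TTheory GRing.Theory Num.Theory.
Import numFieldNormedType.Exports.

Local Open Scope classical_set_scope.
Local Open Scope ring_scope.

(* Let d(n) be the distance from nx to the nearest integer; |sin(pi n x)| >= d(n).
   The points nx mod 1 with 2^k <= n < 2^(k+1) are separated by
   D_k = min d(m) over 0 < m < 2^(k+1), so this dyadic block of the series is
   O(2^(-ks) D_k^(-t)). With c = (s/t - 1)/4 and beta = 1 + 2c, either
   D_k >= 2^(-(k+1) beta) and the block is dominated by a convergent geometric
   series, or D_k = d(q) with q prime to the integer nearest to qx and
   d(q) < q^(-beta). Summing the latter blocks over k for fixed q leaves the sum of
   q^(-s) d(q)^(-t) over such q; if x is not in W*(psi), its terms are
   O((log log q)^(-(1+eps))) for large q. Two such large denominators q < q'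
   satisfy q' >= q^(1+c), so the numbers log log q are separated by log(1+c) and
   the sum converges. *)

(** * Sums of negative powers over separated points *)

Lemma gt0_powRD (R : realType) (y u v : R) : 0 < y ->
  y `^ (u + v) = y `^ u * y `^ v.
Proof. by move=> y0; rewrite powRD// (gt_eqF y0) implybT. Qed.

(** A telescoping bound replaces the integral test: with c = t - 1, each term j^(-t) with j >= 2 is
    at most ((j-1)^(-c) - j^(-c)) / c. *)
Lemma sum_powRN_bounded (R : realType) (t : R) : 1 < t ->
  exists Z : R, forall J : nat, \sum_(1 <= j < J) j%:R `^ (- t) <= Z.
Proof.
move=> t1.
pose c := t - 1.
have c0 : 0 < c by rewrite subr_gt0.
have step (n : nat) : n.+2%:R `^ (- t) * c <=
    n.+1%:R `^ (- c) - n.+2%:R `^ (- c) :> R.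
  have n1 : 0 < n.+1%:R :> R by [].
  have n2 : 0 < n.+2%:R :> R by [].
  have -> : (- t) = - c - 1 by rewrite /c; ring.
  rewrite powRB ?(gt_eqF n2) ?implybT// powRr1 ?(ltW n2)//.
  (* With (n+2)^(-c) factored out, [expR u >= 1 + u] and then [ln (1 + v) <= v] at v = -1/(n+2) give
     the required c/(n+2). *)
  have -> : n.+1%:R `^ (- c) =
      n.+2%:R `^ (- c) * expR (- c * ln (n.+1%:R / n.+2%:R)) :> R.
    rewrite /powR !gt_eqF// -expRD ln_div ?posrE//; congr expR; ring.
  rewrite -mulrA; set A := n.+2%:R `^ (- c).
  rewrite [leRHS](_ : _ = A * (expR (- c * ln (n.+1%:R / n.+2%:R)) - 1)); last by ring.
  rewrite ler_wpM2l ?powR_ge0// lerBrDr addrC (le_trans _ (expR_ge1Dx _))// lerD2l.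
  have := le_ln1Dx (x := - n.+2%:R^-1 : R).
  rewrite ltrN2 invf_lt1 ?ltr1n// => /(_ isT).
  have -> : 1 - n.+2%:R^-1 = n.+1%:R / n.+2%:R :> R.
    by rewrite -[n.+2]addn1 natrD; field; rewrite -natr1 in n2 *; rewrite gt_eqF.
  by move=> h; rewrite mulNr -mulrN mulrC ler_wpM2l ?(ltW c0)// lerNr.
have tel n : \sum_(1 <= j < n.+2) j%:R `^ (- t) <=
    1 + c^-1 * (1 - n.+1%:R `^ (- c)) :> R.
  elim: n => [|n IH]; first by rewrite big_nat1 !powR1 subrr mulr0 addr0.
  rewrite big_nat_recr//= (le_trans (lerD IH (lexx _)))//.
  have := step n; rewrite -ler_pdivlMr// => h; nra.
exists (1 + c^-1) => -[|[|n]].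
- by rewrite big_geq// addr_ge0// invr_ge0 ltW.
- by rewrite big_geq// addr_ge0// invr_ge0 ltW.
by apply: (le_trans (tel n)); rewrite lerD2l ler_piMr ?invr_ge0 ?(ltW c0)//
  lerBlDr lerDl powR_ge0.
Qed.

Lemma ler_sum_uniq (R : numDomainType) (I : eqType) (r1 r2 : seq I) (F : I -> R) :
  uniq r1 -> uniq r2 -> {subset r1 <= r2} -> (forall i, 0 <= F i) ->
  \sum_(i <- r1) F i <= \sum_(i <- r2) F i.
Proof.
move=> u1 u2 sub F0.
have p12 : perm_eq r1 [seq i <- r2 | i \in r1].
  apply: uniq_perm => //; first exact: filter_uniq.
  by move=> i; rewrite mem_filter; case: (boolP (i \in r1)) => // /sub ->.
rewrite (perm_big _ p12)/= big_filter big_mkcond/= ler_sum// => i _.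
by case: ifP.
Qed.

(** Truncation sends 1-separated values to distinct positive integers and never increases them, so
    the sum is at most a partial sum of the integer series. This serves for scaled distances,
    iterated logarithms and scaled powers of two. *)
Lemma sum_powRN_separated (R : realType) (t Z : R) (I : eqType) (r : seq I)
    (g : I -> R) : 0 <= t ->
  (forall J : nat, \sum_(1 <= j < J) j%:R `^ (- t) <= Z) ->
  uniq r -> {in r, forall i, 1 <= g i} ->
  {in r &, forall i j, i != j -> 1 <= `|g i - g j|} ->
  \sum_(i <- r) g i `^ (- t) <= Z.
Proof.
move=> t0 hZ ur g1 gsep.
pose h i := Num.truncn (g i).
have h1 i : i \in r -> (0 < h i)%N by move=> /g1; rewrite truncn_gt0.
apply: (@le_trans _ _ (\sum_(i <- r) (h i)%:R `^ (- t))).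
  rewrite big_seq [leRHS]big_seq ler_sum// => i ir.
  have hi : 0 < (h i)%:R :> R by rewrite ltr0n h1.
  have g0 : 0 < g i by rewrite (lt_le_trans _ (g1 _ ir)).
  rewrite !powRN lef_pV2 ?posrE ?powR_gt0// ge0_ler_powR ?nnegrE ?(ltW hi) ?(ltW g0)//.
  by rewrite truncn_le ltW.
pose J := (\max_(i <- r) h i).+1.
rewrite -(big_map h xpredT (fun j => j%:R `^ (- t))).
apply: (le_trans _ (hZ J)); rewrite ler_sum_uniq ?iota_uniq//.
- rewrite map_inj_in_uniq// => i j ir jr hij; apply/eqP/negPn/negP => /(gsep _ _ ir jr).
  have /andP[a1 a2] := truncn_itv (le_trans ler01 (g1 _ ir)).
  have /andP[b1 b2] := truncn_itv (le_trans ler01 (g1 _ jr)).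
  rewrite -/(h i) -/(h j) hij in a1 a2 b1 b2; rewrite -natr1 in a2 b2.
  by rewrite leNgt ltr_norml; apply/negP/negPn/andP; split; lra.
- move=> _ /mapP[i ir ->]; rewrite mem_index_iota h1//= ltnS.
  exact: leq_bigmax_seq.
Qed.

(** * Distance to the nearest integer and the sine *)

Definition nint (R : realType) (y : R) : int := Num.floor (y + 2^-1).
Definition dnint (R : realType) (y : R) : R := `|y - (nint y)%:~R|.

Lemma dnint_ge0 (R : realType) (y : R) : 0 <= dnint y.
Proof. exact: normr_ge0. Qed.

Lemma dnint_le_half (R : realType) (y : R) : dnint y <= 2^-1.
Proof.
have /andP[] := floor_itv (y + 2^-1); rewrite -/(nint y) intrD => h1 h2.
by rewrite ler_norml; apply/andP; split; lra.
Qed.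

(** Any integer other than [nint y] is at distance at least 1 from it, hence at least 1/2 from
    [y]. *)
Lemma dnint_le (R : realType) (y : R) (p : int) : dnint y <= `|y - p%:~R|.
Proof.
have [->//|np] := eqVneq p (nint y).
have : 1 <= `|(p - nint y)%:~R| :> R.
  by rewrite -intr_norm -[1]/(1%:~R) ler_int -gtz0_ge1 normr_gt0 subr_eq0.
have := dnint_le_half y; have := ler_distD y p%:~R (nint y)%:~R.
rewrite intrB (distrC p%:~R y) -/(dnint y); lra.
Qed.

(** Put w = z/2 <= pi/4. The mean value theorem gives sin w >= w cos(pi/4), and cos w >= cos(pi/4);
    since cos(pi/4)^2 = 1/2, the double angle formula yields sin z >= w. *)
Lemma sin_ge_half (R : realType) (z : R) : 0 <= z <= pi / 2 -> z / 2 <= sin z.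
Proof.
move=> /andP[z0 zpi].
have pi0 := pi_gt0 R.
pose w := z / 2.
have zE : z = w *+ 2 by rewrite /w mulr2n; field.
have c4 : 0 < cos (pi / 4) :> R by rewrite cos_gt0_pihalf//; apply/andP; split; lra.
have c42 : cos (pi / 4) ^+ 2 = 2^-1 :> R.
  have := cos_pihalf R; have -> : pi / 2 = (pi / 4) *+ 2 :> R by rewrite mulr2n; field.
  rewrite cos_mulr2n; lra.
have cosw u : 0 <= u <= pi / 4 -> cos (pi / 4) <= cos u :> R.
  case/andP=> u0 u4; have [->//|un] := eqVneq u (pi / 4).
  by rewrite ltW// ltr_cos ?in_itv/= ?lt_neqAle ?un//; apply/andP; split; lra.
have w0 : 0 <= w by rewrite /w; lra.
have w4 : w <= pi / 4 by rewrite /w; lra.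
have sinw : w * cos (pi / 4) <= sin w.
  have [] := @MVT_segment R sin cos 0 w w0.
  - by apply: continuous_subspaceT => u; exact: continuous_sin.
  move=> u; rewrite in_itv/= sin0 !subr0 => /andP[u0 uw] ->.
  by rewrite mulrC ler_wpM2r// cosw// u0 (le_trans uw).
rewrite [in leRHS]zE sin_mulr2n.
have := cosw w; rewrite w0 w4 => /(_ isT) cw.
have : w * (cos (pi / 4) ^+ 2) <= sin w * cos w.
  by rewrite expr2 mulrA ler_pM// ?mulr_ge0 ?(ltW c4).
 rewrite c42 (mulrC (cos w)) -/w -mulr_natr; move: (sin w * cos w) => S; clearbody w; lra.
Qed.

Lemma norm_sinDnatpi (R : realType) (a : R) (m : nat) : `|sin (a + pi *+ m)| = `|sin a|.
Proof.
elim: m => [|m IH]; first by rewrite mulr0n addr0.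
by rewrite mulrSr addrA sinDpi normrN.
Qed.

Lemma norm_sinDintpi (R : realType) (a : R) (m : int) :
  `|sin (a + pi * m%:~R)| = `|sin a|.
Proof.
case: m => m; first by rewrite -pmulrn mulr_natr norm_sinDnatpi.
rewrite NegzE -(norm_sinDnatpi _ m.+1) mulrNz mulrN -pmulrn mulr_natr.
by rewrite subrK.
Qed.

(** Periodicity replaces [y] by its signed remainder d with |d| <= 1/2; then sin(pi |d|) >= pi |d| /
    2 >= |d|, as pi >= 2. *)
Lemma dnint_le_norm_sin (R : realType) (y : R) : dnint y <= `|sin (pi * y)|.
Proof.
have -> : `|sin (pi * y)| = `|sin (pi * (y - (nint y)%:~R))|.
  by rewrite -[RHS](norm_sinDintpi _ (nint y)) -mulrDr subrK.
have := dnint_le_half y; rewrite /dnint; set d := y - _ => d2.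
have pi2 := pi_ge2 R.
have -> : `|sin (pi * d)| = `|sin (pi * `|d|)|.
  by have [|] := ger0P d => // _; rewrite mulrN sinN normrN.
have n0 := normr_ge0 d.
apply: le_trans (ler_norm _); apply: le_trans (sin_ge_half _) => //.
  by nra.
by apply/andP; split; nra.
Qed.

(** * Separation of multiples and minimal denominators *)

Lemma dnintB_le (R : realType) (y z : R) :
  dnint (y - z) <= `|(y - (nint y)%:~R) - (z - (nint z)%:~R)|.
Proof.
have -> : (y - (nint y)%:~R) - (z - (nint z)%:~R) = (y - z) - (nint y - nint z)%:~R.
  by rewrite intrB; ring.
exact: dnint_le.
Qed.

Lemma dnint_mul_gt0 (R : realType) (x : R) (n : nat) : irrational x -> (0 < n)%N ->
  0 < dnint (n%:R * x).
Proof.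
move=> irr n0; rewrite normr_gt0 subr_eq0; apply/eqP => h; apply: irr.
exists ((nint (n%:R * x))%:~R / n%:R) => //.
rewrite rmorph_div/= ?unitfE ?pnatr_eq0 -?lt0n//
  ratr_int ratr_nat -h mulrAC divff ?mul1r//.
by rewrite pnatr_eq0 -lt0n.
Qed.

(** For n < m < b the signed remainders of mx and nx differ by at least d(m - n) >= D. Among
    remainders of one sign the distances themselves are then D-separated; the two signs account for
    the factor 2. *)
Lemma sum_dnint_block (R : realType) (t Z x D : R) (a b : nat) : 0 <= t ->
  (forall J : nat, \sum_(1 <= j < J) j%:R `^ (- t) <= Z) ->
  0 < D -> (0 < a)%N ->
  (forall m, (0 < m < b)%N -> D <= dnint (m%:R * x)) ->
  \sum_(a <= n < b) dnint (n%:R * x) `^ (- t) <= 2 * Z * D `^ (- t).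
Proof.
move=> t0 hZ D0 a0 hD.
pose r n : R := n%:R * x - (nint (n%:R * x))%:~R.
have sep m n : (0 < m < b)%N -> (0 < n < b)%N -> (m != n)%N -> D <= `|r m - r n|.
  wlog nm : m n / (n < m)%N => [W hm hn|/andP[m0 mb] /andP[n0 nb] _].
    by case: ltngtP => // h _; [rewrite distrC|]; apply: W => //; rewrite gtn_eqF.
  apply: le_trans (dnintB_le _ _); rewrite -mulrBl -natrB ?(ltnW nm)//.
  by rewrite hD// subn_gt0 nm (leq_ltn_trans (leq_subr _ _)).
have half (P : pred nat) : (forall m n, P m -> P n ->
      `|dnint (m%:R * x) - dnint (n%:R * x)| = `|r m - r n|) ->
    \sum_(a <= n < b | P n) dnint (n%:R * x) `^ (- t) <= Z * D `^ (- t).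
  move=> hP; rewrite -big_filter.
  set s := [seq n <- _ | _].
  have sP n : n \in s -> P n /\ (0 < n < b)%N.
    rewrite mem_filter mem_index_iota => /and3P[Pn an ->]; split=> //.
    by rewrite (leq_trans a0 an).
  (* Division by [D] makes the distances 1-separated and at least 1. *)
  rewrite (eq_bigr (fun n => (dnint (n%:R * x) / D) `^ (- t) * D `^ (- t))); last first.
    move=> n _; rewrite -powRM ?divr_ge0 ?dnint_ge0 ?(ltW D0)//.
    by rewrite divfK// gt_eqF.
  rewrite -mulr_suml ler_wpM2r ?powR_ge0//.
  apply: sum_powRN_separated => //; first by rewrite filter_uniq ?iota_uniq.
    by move=> n /sP[_ /hD]; rewrite ler_pdivlMr// mul1r.
  move=> m n /sP[Pm hm] /sP[Pn hn] mn.
  rewrite -mulrBl normrM (gtr0_norm (_ : 0 < D^-1)) ?invr_gt0// ler_pdivlMr// mul1r.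
  by rewrite hP// sep.
rewrite (bigID (fun n => 0 <= r n))/= -mulrA mulr_natl mulr2n.
apply: lerD; apply: half => m n.
  by rewrite /dnint -/(r m) -/(r n) => rm rn; rewrite !(ger0_norm rm) !(ger0_norm rn).
rewrite -!ltNge /dnint -/(r m) -/(r n) => rm rn; rewrite !(ltr0_norm rm) !(ltr0_norm rn).
by rewrite -opprD normrN.
Qed.

Lemma best_denominator (R : realType) (x : R) (b : nat) : (1 < b)%N ->
  exists2 q, (0 < q < b)%N &
    forall m, (0 < m < b)%N -> dnint (q%:R * x) <= dnint (m%:R * x).
Proof.
elim: b => [//|[//|[_ _|b /(_ isT)[q /andP[q0 qb] hq] _]]].
  by exists 1%N => // -[|[|m]].
have [h|h] := leP (dnint (q%:R * x)) (dnint (b.+2%:R * x)).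
  exists q => [|m]; first by rewrite q0 ltnW.
  move=> /andP[m0]; rewrite ltnS leq_eqVlt => /predU1P[->//|mb].
  by apply: hq; rewrite m0.
exists b.+2 => [|m]; first by rewrite ltnSn.
move=> /andP[m0]; rewrite ltnS leq_eqVlt => /predU1P[->//|mb].
by apply: (le_trans (ltW h)); apply: hq; rewrite m0.
Qed.

(** If g divides both q and its nearest numerator, then q/g is still in range and d(q/g) <= d(q)/g.
    Minimality and d(q) > 0 force g = 1. *)
Lemma best_denominator_coprime (R : realType) (x : R) (b q : nat) :
  (0 < q < b)%N -> 0 < dnint (q%:R * x) ->
  (forall m, (0 < m < b)%N -> dnint (q%:R * x) <= dnint (m%:R * x)) ->
  coprimez (nint (q%:R * x)) q.
Proof.
move=> /andP[q0 qb] d0 hq.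
set p := nint _; pose g := gcdn `|p| q.
have g0 : (0 < g)%N by rewrite gcdn_gt0 q0 orbT.
have /dvdnP[q' q'E] : (g %| q)%N by rewrite dvdn_gcdr.
have /dvdzP[p' p'E] : (g %| p)%Z by rewrite dvdzE/= dvdn_gcdl.
have q'0 : (0 < q')%N by move: q0; rewrite q'E muln_gt0 => /andP[].
have gR : 0 < g%:R :> R by rewrite ltr0n.
have dE : dnint (q%:R * x) = g%:R * `|q'%:R * x - p'%:~R|.
  have -> : dnint (q%:R * x) = `|q%:R * x - p%:~R| by [].
  rewrite p'E {1}q'E intrM natrM -[LHS]/(`|_ - _ * g%:R|).
  by rewrite -[X in _ = X * _](gtr0_norm gR) -normrM; congr `|_|; ring.
have : dnint (q%:R * x) <= `|q'%:R * x - p'%:~R|.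
  apply: le_trans (dnint_le _ p'); apply: hq; rewrite q'0 (leq_ltn_trans _ qb)//.
  by rewrite q'E leq_pmulr.
rewrite dE in d0 *; rewrite ger_pMl; last by rewrite -(pmulr_rgt0 _ gR).
rewrite (ler_nat _ _ 1%N) => g1.
by rewrite /coprimez /gcdz/= -/g eqz_nat eqn_leq g1.
Qed.

(** * Good denominators and the gaps between them *)

Definition good_denominator (R : realType) (x beta : R) (q : nat) : bool :=
  [&& (0 < q)%N, coprimez (nint (q%:R * x)) q &
      dnint (q%:R * x) < q%:R `^ (- beta)].

(** Reduced fractions with different denominators are distinct, so the integer p'q - pq' is nonzero
    and 1 <= q' d(q) + q d(q'). The last term is at most 1/2, whence q' >= q^(1+2c) / 2 >=
    q^(1+c). *)
Lemma good_denominator_gap (R : realType) (x c : R) (q q' : nat) : 0 < c ->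
  2 <= q%:R `^ c -> (q < q')%N ->
  good_denominator x (1 + 2 * c) q -> good_denominator x (1 + 2 * c) q' ->
  q%:R `^ (1 + c) <= q'%:R.
Proof.
move=> c0 qc qq' /and3P[q0 cop hq] /and3P[q'0 cop' hq'].
set p := nint _ in cop; set p' := nint _ in cop'.
have qR : 0 < q%:R :> R by rewrite ltr0n.
have q'R : 0 < q'%:R :> R by rewrite ltr0n.
have ne : p' * q%:Z != p * q'%:Z.
  apply/eqP => /(congr1 absz); rewrite !abszM/= => E.
  have d1 : (q %| q')%N.
    by rewrite -(@Gauss_dvdr _ `|p|) -?E ?dvdn_mull// coprime_sym.
  have d2 : (q' %| q)%N.
    by rewrite -(@Gauss_dvdr _ `|p'|) ?E ?dvdn_mull// coprime_sym.
  by have := eqn_dvd q q'; rewrite d1 d2 (ltn_eqF qq').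
have h1 : 1 <= q'%:R * dnint (q%:R * x) + q%:R * dnint (q'%:R * x).
  have : 1 <= `|(p' * q%:Z - p * q'%:Z)%:~R| :> R.
    by rewrite -intr_norm -[1]/(1%:~R) ler_int -gtz0_ge1 normr_gt0 subr_eq0.
  move=> /le_trans; apply.
  have -> : (p' * q%:Z - p * q'%:Z)%:~R =
      q'%:R * (q%:R * x - p%:~R) - q%:R * (q'%:R * x - p'%:~R) :> R.
    rewrite intrB !intrM -!pmulrn; ring.
  by rewrite (le_trans (ler_normB _ _))// !normrM !normr_nat.
have split2 : 1 + 2 * c = 1 + (c + c) by ring.
have e1 : q%:R `^ (1 + 2 * c) = q%:R * (q%:R `^ c * q%:R `^ c) :> R.
  by rewrite split2 !gt0_powRD// powRr1 ?ler0n.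
have e2 : q'%:R `^ (1 + 2 * c) = q'%:R * (q'%:R `^ c * q'%:R `^ c) :> R.
  by rewrite split2 !gt0_powRD// powRr1 ?ler0n.
have q'c : 2 <= q'%:R `^ c :> R.
  rewrite (le_trans qc)// ge0_ler_powR ?nnegrE ?ler_nat ?(ltW c0)//.
  exact: ltnW.
(* Since q < q', this product is at most q'^(-2c), and q'^c >= 2. *)
have h2 : q%:R * dnint (q'%:R * x) <= 2^-1.
  rewrite powRN e2 invfM in hq'.
  have : q%:R * dnint (q'%:R * x) <= q'%:R * (q'%:R^-1 * (q'%:R `^ c * q'%:R `^ c)^-1).
    by rewrite ler_pM ?dnint_ge0 ?ler_nat ?(ltW hq') ?(ltnW qq').
  rewrite mulrA divff ?gt_eqF// mul1r => /le_trans; apply.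
  rewrite lef_pV2 ?posrE ?mulr_gt0 ?powR_gt0//; nra.
have h3 : 2^-1 <= q'%:R * q%:R `^ (- (1 + 2 * c)).
  have : q'%:R * dnint (q%:R * x) <= q'%:R * q%:R `^ (- (1 + 2 * c)).
    by rewrite ler_wpM2l// ltW.
  lra.
rewrite powRN ler_pdivlMr ?powR_gt0// e1 in h3.
rewrite gt0_powRD// powRr1 ?(ltW qR)//.
apply: le_trans h3; rewrite mulrCA ler_wpM2l ?(ltW qR)//.
have := powR_gt0 c qR; nra.
Qed.

Lemma lnln_gap (R : realType) (c y z : R) : 0 < c -> 1 < y ->
  y `^ (1 + c) <= z -> ln (1 + c) <= ln (ln z) - ln (ln y).
Proof.
move=> c0 y1 h.
have y0 : 0 < y by rewrite (lt_trans _ y1).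
have ly : 0 < ln y by rewrite ln_gt0.
have c1 : 0 < 1 + c by rewrite addr_gt0.
have h' : (1 + c) * ln y <= ln z.
  by rewrite -ln_powR ler_ln ?posrE ?powR_gt0// (lt_le_trans _ h) ?powR_gt0.
have lz : 0 < ln z by rewrite (lt_le_trans _ h') ?mulr_gt0.
by rewrite lerBrDr -lnM ?posrE// ler_ln ?posrE// mulr_gt0.
Qed.

(** * Convergence over good denominators and over dyadic blocks *)

Lemma sum_dyadic (V : nmodType) (F : nat -> V) (K : nat) :
  \sum_(1 <= n < 2 ^ K) F n = \sum_(0 <= k < K) \sum_(2 ^ k <= n < 2 ^ k.+1) F n.
Proof.
elim: K => [|K IH]; first by rewrite !big_geq.
rewrite big_nat_recr//= -IH [LHS](@big_cat_nat _ _ _ (2 ^ K))//.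
  by rewrite expn_gt0.
by rewrite leq_exp2l.
Qed.

Lemma sum_good_bounded (R : realType) (x s t eps c K : R) (Q0 : nat) :
  0 < eps -> 0 < c ->
  (forall q, (Q0 <= q)%N -> good_denominator x (1 + 2 * c) q ->
    q%:R `^ (- s) * dnint (q%:R * x) `^ (- t) <= K * ln (ln q%:R) `^ (- (1 + eps))) ->
  0 <= K ->
  exists C : R, forall M,
    \sum_(1 <= q < M | good_denominator x (1 + 2 * c) q)
       q%:R `^ (- s) * dnint (q%:R * x) `^ (- t) <= C.
Proof.
move=> eps0 c0 hF K0.
set good := good_denominator x _.
pose F q : R := q%:R `^ (- s) * dnint (q%:R * x) `^ (- t).
have F0 q : 0 <= F q by rewrite mulr_ge0 ?powR_ge0.
have [|Z hZ] := @sum_powRN_bounded R (1 + eps); first by rewrite ltrDl.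
pose L := ln (1 + c).
have L0 : 0 < L by rewrite ln_gt0// ltrDl.
(* Beyond [Q] the hypothesis on the terms applies, q^c >= 2 as the gap lemma requires, and ln ln q
   >= L; the final 1 keeps q positive. *)
pose Q := maxn Q0 (maxn (Num.truncn (2 `^ c^-1)).+1
  (maxn (Num.truncn (expR (expR L))).+1 1)).
have hQ q : (Q <= q)%N -> [/\ (Q0 <= q)%N, 2 <= q%:R `^ c :> R & L <= ln (ln (q%:R : R))].
  rewrite !geq_max => /and4P[-> h1 h2 q0]; split=> //.
    have : 2 `^ c^-1 <= q%:R :> R.
      by rewrite (le_trans (ltW (truncnS_gt _)))// ler_nat.
    move=> /(ge0_ler_powR (ltW c0)); rewrite !nnegrE powR_ge0 ler0n => /(_ isT isT).
    by rewrite -powRrM mulVf ?gt_eqF// powRr1.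
  have q0' : 0 < q%:R :> R by rewrite ltr0n.
  have h : expR (expR L) <= q%:R.
    by rewrite (le_trans (ltW (truncnS_gt _)))// ler_nat.
  have h3 : expR L <= ln q%:R by rewrite -(expRK (expR L)) ler_ln ?posrE// expR_gt0.
  by rewrite -{1}(expRK L) ler_ln ?posrE ?expR_gt0// (lt_le_trans _ h3)// expR_gt0.
exists (\sum_(1 <= q < Q) F q + K * L `^ (- (1 + eps)) * Z) => M.
rewrite (bigID (fun q => (q < Q)%N))/= lerD//.
  rewrite -big_filter ler_sum_uniq ?filter_uniq ?iota_uniq// => q.
  by rewrite mem_filter !mem_index_iota => /andP[/andP[_ ->] /andP[->]].
rewrite -big_filter; set r := [seq q <- _ | _].
have rP q : q \in r -> good q /\ (Q <= q)%N.
  by rewrite mem_filter -leqNgt => /andP[/andP[]].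
(* Scaling by [L], the least gap between the values ln ln q, makes them 1-separated. *)
apply: (@le_trans _ _ (\sum_(q <- r) K * L `^ (- (1 + eps)) *
    (ln (ln q%:R) / L) `^ (- (1 + eps)))).
  rewrite big_seq [leRHS]big_seq ler_sum// => q /rP[gq /hQ[Q0q _ lq]].
  apply: le_trans (hF _ Q0q gq) _.
  rewrite -mulrA -powRM ?divr_ge0 ?(ltW L0) ?(le_trans _ lq) ?(ltW L0)//.
  by rewrite (mulrC L) divfK ?gt_eqF.
rewrite -mulr_sumr ler_wpM2l ?mulr_ge0 ?powR_ge0//.
apply: sum_powRN_separated => //.
- by rewrite addr_ge0 ?(ltW eps0).
- by rewrite filter_uniq ?iota_uniq.
- by move=> q /rP[_ /hQ[_ _ lq]]; rewrite ler_pdivlMr// mul1r.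
move=> q q' /rP[gq /hQ[_ qc lq]] /rP[gq' /hQ[_ q'c lq']] qq'.
rewrite -mulrBl normrM (gtr0_norm (_ : 0 < L^-1)) ?invr_gt0// ler_pdivlMr// mul1r.
wlog lt : q q' gq gq' qc q'c lq lq' qq' / (q < q')%N => [W|].
  have [h|h|E] := ltngtP q q'; first exact: W.
    by rewrite distrC; apply: W => //; rewrite eq_sym.
  by rewrite E eqxx in qq'.
rewrite distrC (le_trans _ (ler_norm _))// lnln_gap//; last first.
  exact: good_denominator_gap gq gq'.
(* Here q > 1, because q <= 1 would give q^c <= 1. *)
rewrite (ltr_nat _ 1) ltnNge; apply/negP => q1.
have : q%:R `^ c <= 1 `^ c :> R.
  by rewrite ge0_ler_powR ?nnegrE ?(ltW c0)// (ler_nat _ _ 1).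
by rewrite powR1 leNgt (lt_le_trans _ qc)// ltr1n.
Qed.

(** The ratios 2^(k+1)/q exceed 1 and are 1-separated, since consecutive ones differ by 2^(k+1)/q.
    The factor 2^s pays for passing from 2^k to 2^(k+1). *)
Lemma sum_powRN_dyadic_le (R : realType) (s Z : R) (q K : nat) : 0 <= s ->
  (forall J : nat, \sum_(1 <= j < J) j%:R `^ (- s) <= Z) -> (0 < q)%N ->
  \sum_(0 <= k < K | (q < 2 ^ k.+1)%N) (2 ^ k)%:R `^ (- s) <=
    Z * 2 `^ s * q%:R `^ (- s) :> R.
Proof.
move=> s0 hZ q0; have qR : 0 < q%:R :> R by rewrite ltr0n.
rewrite -big_filter (eq_bigr (fun k => ((2 ^ k.+1)%:R / q%:R) `^ (- s) *
    (2 `^ s * q%:R `^ (- s)))); last first.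
  move=> k _; rewrite mulrCA -powRM ?divr_ge0// divfK ?gt_eqF//.
  by rewrite expnS natrM powRM// mulrA -gt0_powRD// subrr powRr0 mul1r.
rewrite -mulr_suml -mulrA ler_wpM2r ?mulr_ge0 ?powR_ge0//.
apply: sum_powRN_separated => //.
- by rewrite filter_uniq ?iota_uniq.
- move=> k; rewrite mem_filter => /andP[qk _].
  by rewrite ler_pdivlMr// mul1r ler_nat ltnW.
move=> k l; rewrite !mem_filter => /andP[qk _] /andP[ql _] kl.
wlog lt : k l qk ql kl / (k < l)%N => [W|].
  have [h|h|E] := ltngtP k l; first exact: W.
    by rewrite distrC; apply: W => //; rewrite eq_sym.
  by rewrite E eqxx in kl.
rewrite distrC (le_trans _ (ler_norm _))// -mulrBl ler_pdivlMr// mul1r.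
rewrite lerBrDr -natrD ler_nat.
apply: (@leq_trans (2 ^ k.+1 + 2 ^ k.+1)); first by rewrite leq_add2r ltnW.
by rewrite addnn -mul2n -expnS leq_exp2l.
Qed.

Lemma sum_dnint_dyadic_bounded (R : realType) (x s t beta C : R) :
  irrational x -> 1 < s -> 1 < t -> 0 <= beta -> beta * t < s ->
  (forall M, \sum_(1 <= q < M | good_denominator x beta q)
       q%:R `^ (- s) * dnint (q%:R * x) `^ (- t) <= C) ->
  exists C' : R, forall K,
    \sum_(1 <= n < 2 ^ K) n%:R `^ (- s) * dnint (n%:R * x) `^ (- t) <= C'.
Proof.
move=> irr s1 t1 b0 bs hC.
have s0 : 0 <= s by rewrite ltW// (lt_trans _ s1).
have t0 : 0 <= t by rewrite ltW// (lt_trans _ t1).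
have [Zs hZs] := sum_powRN_bounded s1.
have [Zt hZt] := sum_powRN_bounded t1.
have Zs0 : 0 <= Zs by have := hZs 0%N; rewrite big_geq.
have Zt0 : 0 <= Zt by have := hZt 0%N; rewrite big_geq.
set good := good_denominator x beta in hC *.
pose d q := dnint (q%:R * x).
have d0 q : (0 < q)%N -> 0 < d q by exact: dnint_mul_gt0.
pose r : R := 2 `^ (beta * t - s).
have r0 : 0 < r by rewrite powR_gt0.
have r1 : r < 1.
  by rewrite /r /powR gt_eqF// expR_lt1 nmulr_rlt0 ?subr_lt0// ln_gt0// ltr1n.
(* A block of the second kind is controlled by one good q; summing over all good q < 2^(k+1) avoids
   having to select it. *)
pose G (k : nat) : R :=
  \sum_(1 <= q < 2 ^ k.+1 | good q) (2 ^ k)%:R `^ (- s) * d q `^ (- t).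
have G0 k : 0 <= G k by rewrite sumr_ge0// => q _; rewrite mulr_ge0 ?powR_ge0.
have block k : \sum_(2 ^ k <= n < 2 ^ k.+1) n%:R `^ (- s) * d n `^ (- t) <=
    2 * Zt * (2 `^ (beta * t) * r ^+ k + G k).
  have k0 : (0 < 2 ^ k)%N by rewrite expn_gt0.
  have k1 : (1 < 2 ^ k.+1)%N by rewrite (ltn_exp2l 0).
  have [q /andP[q0 qk] hq] := best_denominator x k1.
  apply: (@le_trans _ _ ((2 ^ k)%:R `^ (- s) * (2 * Zt * d q `^ (- t)))).
    apply: (@le_trans _ _ (\sum_(2 ^ k <= n < 2 ^ k.+1)
        (2 ^ k)%:R `^ (- s) * d n `^ (- t))).
      rewrite big_nat [leRHS]big_nat ler_sum// => n /andP[kn _].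
      rewrite ler_wpM2r ?powR_ge0// !powRN lef_pV2 ?posrE ?powR_gt0 ?ltr0n
        ?(leq_trans k0)//.
      by rewrite ge0_ler_powR ?nnegrE ?ler_nat.
    rewrite -mulr_sumr ler_wpM2l ?powR_ge0//.
    by apply: sum_dnint_block => //; exact: d0.
  rewrite mulrCA ler_wpM2l ?mulr_ge0//.
  (* If the minimal distance is large, its power is at most 2^((k+1) beta t), which leaves the
     geometric term; otherwise the minimizer q is good. *)
  have [dq|dq] := leP ((2 ^ k.+1)%:R `^ (- beta)) (d q).
    apply: ler_wpDr => //.
    have : d q `^ (- t) <= (2 ^ k.+1)%:R `^ (beta * t).
      rewrite (_ : beta * t = - beta * - t); last by ring.
      rewrite powRrM !(powRN _ t) lef_pV2 ?posrE ?powR_gt0 ?d0 ?ltr0n ?expn_gt0//.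
      by rewrite ge0_ler_powR ?nnegrE ?powR_ge0 ?(ltW (d0 _ _)).
    move=> /(ler_wpM2l (powR_ge0 (2 ^ k)%:R (- s))) /le_trans; apply.
    rewrite expnS natrM powRM// natrX mulrCA -powR_mulrn// -powR_mulrn ?(ltW r0)//.
    rewrite /r -!powRrM ler_wpM2l ?powR_ge0// -gt0_powRD//.
    by rewrite (_ : k%:R * - s + k%:R * (beta * t) = (beta * t - s) * k%:R); last by ring.
  apply: ler_wpDl; first by rewrite mulr_ge0 ?powR_ge0 ?exprn_ge0 ?(ltW r0).
  have gq : good q.
    rewrite /good /good_denominator q0 (best_denominator_coprime _ (d0 _ q0) hq) ?q0//=.
    rewrite (lt_le_trans dq)// !powRN lef_pV2 ?posrE ?powR_gt0 ?ltr0n ?expn_gt0//.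
    by rewrite ge0_ler_powR ?nnegrE ?ler_nat// ltnW.
  rewrite /G -big_filter (bigD1_seq q) ?filter_uniq ?iota_uniq//=; last first.
    by rewrite mem_filter gq mem_index_iota q0.
  by rewrite lerDl sumr_ge0// => i _; rewrite mulr_ge0 ?powR_ge0.
exists (2 * Zt * (2 `^ (beta * t) * (1 - r)^-1 + Zs * 2 `^ s * C)) => K.
rewrite sum_dyadic; apply: (le_trans (ler_sum _ (fun k _ => block k))).
rewrite -mulr_sumr ler_wpM2l ?mulr_ge0// big_split/= -mulr_sumr lerD//.
  rewrite ler_wpM2l ?powR_ge0//.
  have := @geometric_le_lim R K 1 r ler01 r0.
  rewrite gtr0_norm// mul1r => /(_ r1); rewrite /series/=.
  by under eq_bigr do rewrite mul1r.
(* The range of q is made independent of k, so that the two sums can be exchanged. *)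
apply: (@le_trans _ _ (\sum_(0 <= k < K)
    \sum_(1 <= q < 2 ^ K | good q && (q < 2 ^ k.+1)%N)
    (2 ^ k)%:R `^ (- s) * d q `^ (- t))).
  rewrite big_nat [leRHS]big_nat ler_sum// => k /= kK.
  by rewrite /G [leLHS](@big_nat_widen _ _ _ _ _ (2 ^ K)%N) ?leq_exp2l.
rewrite (exchange_big_dep good)/=; last by move=> k q _ /andP[].
apply: le_trans (ler_wpM2l _ (hC (2 ^ K)%N)); last by rewrite mulr_ge0 ?powR_ge0.
rewrite mulr_sumr big_nat_cond [leRHS]big_nat_cond ler_sum// => q /andP[/andP[q0 _] gq].
rewrite -mulr_suml mulrA ler_wpM2r ?powR_ge0//.
rewrite (eq_bigl (fun k => q < 2 ^ k.+1)%N); last by move=> k; rewrite gq.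
exact: sum_powRN_dyadic_le.
Qed.

(** * The approximation function and the inclusion *)

Lemma powRN_psi_formula (R : realType) (s t eps : R) (q : nat) :
  1 < t -> t < s -> (0 < q)%N -> 0 <= ln (ln (q%:R : R)) ->
  q%:R `^ (- s) * (q%:R * psi_formula s t eps q) `^ (- t) =
  Lambda s t `^ (- (1 + eps)) * ln (ln q%:R) `^ (- (1 + eps)).
Proof.
move=> t1 st q0 l0.
have qR : 0 < q%:R :> R by rewrite ltr0n.
have tn0 : t != 0 by rewrite gt_eqF// (lt_trans _ t1).
rewrite /psi_formula; set a := (1 + eps) / t.
rewrite !powRM ?mulr_ge0 ?powR_ge0// -!powRrM.
(* The exponents are tuned to this: a t = 1 + eps, and tau t = s + t cancels every power of q. *)
have -> : a * - t = - (1 + eps) by rewrite /a; field.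
have -> : - tau s t * - t = s + t by rewrite /tau; field.
rewrite [LHS](_ : _ = Lambda s t `^ (- (1 + eps)) * ln (ln q%:R) `^ (- (1 + eps)) *
  (q%:R `^ (- s) * q%:R `^ (- t) * q%:R `^ (s + t))); last by ring.
by rewrite -!gt0_powRD// [_ + (s + t)](_ : _ = 0) ?powRr0 ?mulr1//; ring.
Qed.

(** A finite set of approximating pairs has bounded denominators, so [Q] can be one more than the
    largest. *)
Lemma not_Wstar_eventually (R : realType) (psi : nat -> R) (x : R) :
  ~ Wstar psi x -> exists Q : nat, forall (q : nat) (p : int), (Q <= q)%N ->
    (0 < q)%N -> coprimez p q -> psi q <= `|x - p%:~R / q%:R|.
Proof.
move=> /contrapT /finite_seqP[l hl].
exists (\max_(pq <- l) pq.2).+1 => q p Qq q0 cop.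
rewrite leNgt; apply/negP => h.
have : [set` l] (p, q) by rewrite -hl; split.
move=> /= pql.
have := leq_bigmax_seq (P := xpredT) (F := snd) _ pql isT.
by rewrite leqNgt Qq.
Qed.

Unset Implicit Arguments.

Theorem lemma7p3 (R : realType) (s t : R) (ht : 1 < t) (hst : t < s)
    (eps : R) (heps : 0 < eps) (psi : nat -> R)
    (psi_gt0 : forall q : nat, (0 < q)%N -> 0 < psi q)
    (psiE : forall q : nat, Qstar s t <= q%:R -> psi q = psi_formula s t eps q) :
  Dset s t `<=` Wstar psi.
Proof.
move=> x [irr dvg]; apply: contrapT => /not_Wstar_eventually[Q hQ].
have t0 : 0 < t by rewrite (lt_trans _ ht).
have s1 : 1 < s by rewrite (lt_trans ht).
have st1 : 1 < s / t by rewrite ltr_pdivlMr// mul1r.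
(* This makes [beta] the midpoint of 1 and s/t, so beta > 1 and beta t < s; moreover 1 + c is
   [base s t]. *)
pose c := (s / t - 1) / 4.
have c0 : 0 < c by rewrite /c; lra.
pose beta := 1 + 2 * c.
have b0 : 0 <= beta by rewrite /beta; lra.
have bs : beta * t < s by rewrite -ltr_pdivlMr// /beta /c; lra.
pose Q0 := maxn Q (Num.truncn (Qstar s t)).+1.
have [||C hC] := @sum_good_bounded R x s t eps c (Lambda s t `^ (- (1 + eps))) Q0 heps c0.
- move=> q; rewrite geq_max => /andP[Qq Q'q] /and3P[q0 cop _].
  have Qsq : Qstar s t <= q%:R.
    by rewrite (le_trans (ltW (truncnS_gt _)))// ler_nat.
  have qR : 0 < q%:R :> R by rewrite ltr0n.
  (* This uses the entry e^e in the maximum [Qstar]. *)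
  have lq : 1 <= ln (ln (q%:R : R)).
    have h1 : expR 1 <= ln (q%:R : R).
      rewrite -(expRK (expR 1)) ler_ln ?posrE ?expR_gt0//.
      by apply: le_trans Qsq; rewrite le_max lexx.
    by rewrite -{1}(expRK 1) ler_ln ?posrE ?expR_gt0// (lt_le_trans _ h1)// expR_gt0.
  rewrite -powRN_psi_formula ?(le_trans ler01)// -psiE// ler_wpM2l ?powR_ge0//.
  have le_d : q%:R * psi q <= dnint (q%:R * x).
    apply: le_trans (ler_wpM2l (ltW qR) (hQ _ _ Qq q0 cop)) _.
    rewrite -{1}(gtr0_norm qR) -normrM mulrBr mulrCA divff ?gt_eqF// mulr1.
    exact: lexx.
  have pq : 0 < q%:R * psi q by rewrite mulr_gt0// psi_gt0.
  rewrite !powRN lef_pV2 ?posrE ?powR_gt0 ?(lt_le_trans pq)//.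
  by rewrite ge0_ler_powR ?nnegrE ?(ltW pq) ?(ltW t0) ?dnint_ge0.
- exact: powR_ge0.
have [C' hC'] := sum_dnint_dyadic_bounded irr s1 ht b0 bs hC.
pose u n : R := n%:R `^ (- s) * `|sin (pi * n%:R * x)| `^ (- t).
have u0 n : 0 <= u n by rewrite mulr_ge0 ?powR_ge0.
suff : (\sum_(1 <= n <oo) (u n)%:E <= C'%:E)%E by rewrite dvg leye_eq.
apply: lime_le.
  by apply: is_cvg_nneseries => n _ _; rewrite lee_fin.
apply: nearW => n; rewrite sumEFin lee_fin; apply: le_trans (hC' n).
(* As n < 2^n, each partial sum is contained in a full dyadic one. *)
apply: (@le_trans _ _ (\sum_(1 <= i < 2 ^ n) u i)).
  rewrite ler_sum_uniq ?iota_uniq// => i; rewrite !mem_index_iota => /andP[-> iln].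
  exact: ltn_trans iln (ltn_expl n (ltnSn 1)).
rewrite big_nat [leRHS]big_nat ler_sum// => i /andP[i0 _].
(* Irrationality keeps the sine nonzero; this matters because a negative power of 0 is 0 by
   convention. *)
have d0 : 0 < dnint (i%:R * x) by exact: dnint_mul_gt0.
have ds : dnint (i%:R * x) <= `|sin (pi * i%:R * x)|.
  by rewrite -mulrA dnint_le_norm_sin.
rewrite ler_wpM2l ?powR_ge0// !powRN lef_pV2 ?posrE ?powR_gt0 ?(lt_le_trans d0)//.
by rewrite ge0_ler_powR ?nnegrE ?(ltW d0) ?(ltW t0).
Qed.
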